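(* Let $m\ge 1$, let $n\ge 0$ be an integer, and let $K$ and $V$ be convex bodies in $\mathbb{R}^m$ that are centrally symmetric with respect to the origin. For every $P\in\mathcal{P}_{n,m}$ and $x\in V$, $$\|\nabla P(x)\|_K\le M(K,V^* )\,n^2\,\|P\|_{C(V)}.\qquad( * )$$ Let $\mathbf{a}^*\in\partial(V^* )$ be any point with $\|\mathbf{a}^*\|_K=M(K,V^* )$. Equality holds in $( * )$ for $P(x)=P_0(x):=C\,T_n((\mathbf{a}^*,x))$, $C\in\mathbb{C}$, and $x=x_0\in V\cap H_\pm(\mathbf{a}^* )$, where $H_\pm(\mathbf{a}^* ):=\{x\in\mathbb{R}^m:(\mathbf{a}^*,x)=\pm1\}$ are parallel supporting hyperplanes of $V$. Hence inequality $( * )$ is sharp.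
   Context: $(t,y)=\sum_{j=1}^m t_jy_j$; $\nabla P(x)=(\partial P(x)/\partial x_1,\ldots,\partial P(x)/\partial x_m)$. A convex body is a compact convex set with non-empty interior; $\partial(V)$ is the boundary of $V$. For an origin-symmetric convex body $V$, its polar is $V^*=\{y\in\mathbb{R}^m: |(t,y)|\le 1 \text{ for all } t\in V\}$ (and $V^{**}=V$). The norm $\|x\|_K:=\max_{t\in K^*}|(t,x)|$ on $\mathbb{R}^m$ has unit ball $K$; for complex vectors $z\in\mathbb{C}^m$, $\|z\|_K:=\max_{t\in K^*}|\sum_{j=1}^m t_jz_j|$. Define $M(K,V):=\max_{y\in V}\|y\|_K$, so $M(K,V^* )=\max_{y\in V^*}\|y\|_K$. $\mathcal{P}_{n,m}$ is the set of all polynomials $P(x)=\sum_{|\alpha|\le n}c_\alpha x^\alpha$ in $m$ variables of total degree at most $n$ with complex coefficients; $\|P\|_{C(V)}=\sup_{x\in V}|P(x)|$. $T_n$ is the Chebyshev polynomial of the first kind, $T_n(s)=\cos(n\arccos s)$ for $s\in[-1,1]$. *)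

(* Defs.v *)
From HB Require Import structures.
From mathcomp Require Import all_boot all_order all_algebra.
From mathcomp.multinomials Require Export mpoly.
From mathcomp Require Export all_classical all_reals all_analysis.
From mathcomp Require Export complex.
From mathcomp Require Import ring.

Set Implicit Arguments.
Unset Strict Implicit.
Unset Printing Implicit Defensive.

Import Order.TTheory GRing.Theory Num.Theory.
Import numFieldNormedType.Exports.

Local Open Scope classical_set_scope.
Local Open Scope ring_scope.
Local Open Scope complex_scope.

Section ConvexGeometry.
Variables (R : realType) (m : nat).
Implicit Types (t x y a : 'rV[R]_m) (K V W H : set 'rV[R]_m).

Definition dot t y : R := \sum_(j < m) t 0 j * y 0 j.

Definition convex_body V : Prop :=
  [/\ compact V, convex_set V & interior V !=set0].

Definition origin_symmetric V : Prop := forall x, V x -> V (- x).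

Definition boundary V : set 'rV[R]_m := closure V `\` interior V.

Definition polar V : set 'rV[R]_m :=
  [set y | forall t, V t -> `|dot t y| <= 1].

(* The three suprema below are the maxima of continuous functions on the
   nonempty compact sets K^* and V^*, for convex bodies K and V. *)
Definition rnorm K x : R := sup [set `|dot t x| | t in polar K].

Definition cdot t (z : 'rV[R[i]]_m) : R[i] := \sum_(j < m) (t 0 j)%:C * z 0 j.

(* [normc] is the [R]-valued modulus; [`|z|] would have type [R[i]]. *)
Definition cnorm K (z : 'rV[R[i]]_m) : R :=
  sup [set ComplexField.Normc.normc (cdot t z) | t in polar K].

Definition maxnorm K W : R := sup [set rnorm K y | y in W].

Definition hyperplane a (c : R) : set 'rV[R]_m := [set x | dot a x = c].

Definition supporting_hyperplane V H : Prop :=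
  exists b c, [/\ b != 0, H = hyperplane b c, V `&` H !=set0 &
    forall x, V x -> dot b x <= c].

End ConvexGeometry.

Section Polynomials.
Variables (R : realType) (m : nat).
Implicit Types (P : {mpoly R[i][m]}) (x a : 'rV[R]_m) (V : set 'rV[R]_m).

(* [msize P] is the total degree plus one, and 0 for P = 0. *)
Definition poly_space (n : nat) : set {mpoly R[i][m]} :=
  [set P | (msize P <= n.+1)%N].

Definition peval P x : R[i] := P.@[fun j => (x 0 j)%:C].

Definition supnorm V P : R :=
  sup [set ComplexField.Normc.normc (peval P x) | x in V].

Definition gradient P x : 'rV[R[i]]_m := \row_(j < m) peval (P^`M(j)) x.

End Polynomials.

Fixpoint chebyshev (R : nzRingType) (n : nat) : {poly R} :=
  match n with
  | 0 => 1
  | 1 => 'X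
  | (n''.+1 as n').+1 => 2%:R *: ('X * chebyshev R n') - chebyshev R n''
  end.

Lemma chebyshev_cos (R : realType) (n : nat) (s : R) :
  -1 <= s <= 1 -> (chebyshev R n).[s] = cos (n%:R * acos s).
Proof.
move=> s1; have cs : cos (acos s) = s by apply: acosK; rewrite in_itv.
suff : (chebyshev R n).[s] = cos (n%:R * acos s) /\
       (chebyshev R n.+1).[s] = cos (n.+1%:R * acos s) by case.
elim: n => [|n [IH0 IH1]].
  by rewrite /= hornerC hornerX mul0r cos0 mul1r cs.
split=> //; rewrite [chebyshev R n.+2]/= -/(chebyshev R n.+1).
rewrite hornerD hornerN hornerZ hornerM hornerX IH0 IH1.
set b := acos s in cs *; set c := n.+1%:R * b.
have -> : n%:R * b = c - b by rewrite /c -natr1 mulrDl mul1r addrK.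
have -> : n.+2%:R * b = c + b by rewrite /c -[n.+2%:R]natr1 mulrDl mul1r.
rewrite cosB cosD cs.
by rewrite [cos c * s]mulrC; ring.
Qed.

(* The polynomial x |-> C T_n((a, x)). *)
Definition chebyshev_ridge (R : realType) (m n : nat) (a : 'rV[R]_m)
    (C : R[i]) : {mpoly R[i][m]} :=
  C *: (map_poly (fun c : R => (c%:C)%:MP_[m]) (chebyshev R n)).[
         \sum_(j < m) (a 0 j)%:C *: 'X_j].

Lemma chebyshev_ridgeE (R : realType) (m n : nat) (a x : 'rV[R]_m) (C : R[i]) :
  peval (chebyshev_ridge n a C) x = C * ((chebyshev R n).[dot a x])%:C.
Proof.
rewrite /peval /chebyshev_ridge mevalZ; congr (_ * _).
set v := fun j => _; pose f := [the {rmorphism _ -> _} of meval v].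
pose g := [the {rmorphism _ -> _} of (@mpolyC m R[i]) \o (real_complex R)].
rewrite -[LHS]/(f _) -horner_map -map_poly_comp /=.
have -> : meval v (\sum_(j < m) (a 0 j)%:C *: 'X_j) = (dot a x)%:C.
  rewrite raddf_sum /dot rmorph_sum; apply: eq_bigr => j _.
  by rewrite /= mevalZ mevalXU rmorphM.
rewrite -[RHS]horner_map; congr (_.[_]).
by apply: eq_map_poly => c; rewrite /= mevalC.
Qed.

(* Main.v *)
Require Import Defs.
From HB Require Import structures.
From mathcomp Require Import all_boot all_order all_algebra.
From mathcomp.multinomials Require Import mpoly.
From mathcomp Require Import all_classical all_reals all_analysis.
From mathcomp Require Import complex ring lra.

(** Write D_y P(x) for the derivative of P at x in the direction y, and let
    B be the supremum of |P| over V.  Since cnorm K (gradient P x) is the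
    supremum of |D_t P(x)| over t in the polar K^*, the inequality says that
    |D_t P(x)| <= M n^2 B for t in K^*, where M is the maximum of |(t, y)| over
    t in K^* and y in V^*.  By the definition of M, t / M lies in the bipolar
    V^**, which is V ([bipolar]).  It is therefore enough to show that
    |D_y P(x)| <= n^2 B for all x and y in V ([markov_directional]).

    That bound comes from using one univariate fact twice.  Schur's
    inequality at the endpoint ([schur_inequality_at1]): if deg h < n and
    sqrt (1 - s^2) |h(s)| <= L on [-1, 1], then |h(1)| <= n L.  It follows from
    Lagrange interpolation of h at the zeros of T_n, because the weights there
    are controlled by T_n' and sum to T_n'(1) / n = n.

    - Bernstein step.  Fix z and w such that the ellipse c z + q w,
      c^2 + q^2 = 1, lies in V.  Reducing powers of q by q^2 = 1 - c^2 gives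
      P(c z + q w) = A(c) + q h(c) with deg h < n and h(1) = D_w P(z)
      ([elliptic_decomposition]).  The part odd in q is bounded by B, which is
      the hypothesis of Schur's inequality for h; hence |D_w P(z)| <= n B.
    - Markov step.  For x and y in V and |s| <= 1, the ellipse with z = s x and
      w = sqrt (1 - s^2) y lies in V by Cauchy-Schwarz, as V is convex and
      symmetric.  So sqrt (1 - s^2) |D_y P(s x)| <= n B, and Schur's inequality
      for the polynomial s |-> D_y P(s x), of degree less than n, gives the
      claim at s = 1.

    For sharpness, D_t of C T_n((a, x)) is C T_n'((a, x)) (t, a), and
    |T_n'(1)| = |T_n'(-1)| = n^2, while |T_n| <= 1 on [-1, 1].  A boundary point
    a of V^* satisfies (a, x) = 1 for some x in V, since otherwise |(a, .)|
    would stay below 1 on the compact set V and a would be interior.  A point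
    of V^* where the norm takes its maximum M > 0 is on the boundary, since
    otherwise it could be scaled up. *)

Set Implicit Arguments.
Unset Strict Implicit.
Unset Printing Implicit Defensive.

Import Order.TTheory GRing.Theory Num.Theory.
Import numFieldNormedType.Exports.

Local Open Scope classical_set_scope.
Local Open Scope ring_scope.
Local Open Scope complex_scope.

(* Disambiguates from the lemma of the same name in probability theory. *)
Local Notation chebyshevT := Defs.chebyshev.

(** * Chebyshev polynomials and Schur's inequality at an endpoint *)

(** Lagrange interpolation with the basis polynomials written as
    p / (p'(a) (X - a)), so that only the values of p' at the nodes are needed
    and no leading coefficient. *)
Lemma lagrange_root_formula (F : fieldType) (p f : {poly F}) (s : seq F)
    (x : F) :
  uniq s -> all (root p) s -> (size p <= (size s).+1)%N ->
  {in s, forall a, p^`().[a] != 0} -> (size f <= size s)%N -> x \notin s ->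
  f.[x] = \sum_(a <- s) f.[a] * p.[x] / (p^`().[a] * (x - a)).
Proof.
move=> us /allP ps szp p'0 szf xs.
pose q a := p %/ ('X - a%:P).
have qE a : a \in s -> p = q a * ('X - a%:P).
  by move=> /ps; rewrite -dvdp_XsubCl => /divpK.
have q_diag a : a \in s -> (q a).[a] = p^`().[a].
  move=> /qE e; rewrite [in RHS]e derivM derivXsubC mulr1 hornerD hornerM.
  by rewrite hornerXsubC subrr mulr0 add0r.
have q_off a b : a \in s -> b \in s -> a != b -> (q a).[b] = 0.
  move=> sa sb ab; have /eqP := rootP (ps b sb).
  rewrite {1}(qE a sa) hornerM hornerXsubC mulf_eq0 subr_eq0 [b == a]eq_sym.
  by rewrite (negPf ab) orbF => /eqP.
have szq a : a \in s -> (size (q a) <= size s)%N.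
  by move=> sa; rewrite size_divp ?polyXsubC_eq0// size_XsubC leq_subLR.
pose g := \sum_(a <- s) (f.[a] / p^`().[a]) *: q a.
have fg : f = g.
  apply/eqP; rewrite -subr_eq0; apply/eqP.
  apply: (roots_geq_poly_eq0 (rs := s)) => //.
    apply/allP => b sb; apply/rootP; rewrite hornerD hornerN horner_sum.
    rewrite (bigD1_seq b)//= big_seq_cond big1 => [|a /andP[sa ab]].
      by rewrite hornerZ q_diag// mulfVK ?p'0// addr0 subrr.
    by rewrite hornerZ q_off// mulr0.
  apply: leq_trans (size_polyD _ _) _; rewrite geq_max szf size_polyN /=.
  rewrite /g big_seq; elim/big_rec: _ => [|a h sa IH]; first by rewrite size_poly0.
  apply: leq_trans (size_polyD _ _) _; rewrite geq_max IH andbT.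
  by apply: leq_trans (size_scale_leq _ _) (szq _ sa).
rewrite {1}fg horner_sum big_seq [RHS]big_seq; apply: eq_bigr => a sa.
have xa : x - a != 0 by rewrite subr_eq0; apply: contraNneq xs => ->.
have -> : p.[x] = (q a).[x] * (x - a).
  by rewrite {1}(qE a sa) hornerM hornerXsubC.
by rewrite hornerZ; field; rewrite xa p'0.
Qed.

(** This is the Chebyshev polynomial of the second kind with its index
    shifted, U_(n-1).  The recursion is the addition formula for
    sin (n + 1) b / sin b. *)
Fixpoint chebyshevV (R : nzRingType) (n : nat) : {poly R} :=
  if n is n'.+1 then 'X * chebyshevV R n' + chebyshevT R n' else 0.

(** The addition formula for cos (n + 1) b. *)
Lemma chebyshevS (R : comNzRingType) (n : nat) :
  chebyshevT R n.+1 = 'X * chebyshevT R n - (1 - 'X ^+ 2) * chebyshevV R n.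
Proof.
elim: n => [|n IH]; first by rewrite /= mulr0 subr0 mulr1.
rewrite [LHS]/= -/(chebyshevT R n.+1) [chebyshevV _ _]/= scaler_nat {2}IH IH.
by rewrite -mulr_natl; ring.
Qed.

Lemma chebyshevV_SS (R : comNzRingType) (n : nat) :
  chebyshevV R n.+2 = 2%:R *: ('X * chebyshevV R n.+1) - chebyshevV R n.
Proof.
by rewrite [LHS]/= -/(chebyshevT R n.+1) chebyshevS /= scaler_nat -mulr_natl; ring.
Qed.

Lemma chebyshev_pythagoras (R : comNzRingType) (n : nat) :
  chebyshevT R n ^+ 2 + (1 - 'X ^+ 2) * chebyshevV R n ^+ 2 = 1.
Proof.
elim: n => [|n IH]; first by rewrite /= expr0n mulr0 addr0 expr1n.
by rewrite chebyshevS -[RHS]IH /=; ring.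
Qed.

(** Two consecutive indices are carried through the induction because the
    recurrence of T_n has order two. *)
Lemma deriv_chebyshev (R : comNzRingType) (n : nat) :
  (chebyshevT R n)^`() = n%:R *: chebyshevV R n.
Proof.
suff: (chebyshevT R n)^`() = n%:R *: chebyshevV R n /\
      (chebyshevT R n.+1)^`() = n.+1%:R *: chebyshevV R n.+1 by case.
elim: n => [|n [IH0 IH1]].
  by rewrite /= derivC scaler0 derivX mulr0 add0r scale1r.
split=> //; rewrite chebyshevV_SS [chebyshevT R n.+2]/= -/(chebyshevT R n.+1).
rewrite derivB derivZ derivM derivX mul1r IH0 IH1 chebyshevS /=.
rewrite -[n.+2%:R]natr1 -[n.+1%:R]natr1 -!mul_polyC !polyCD polyC1.
move: (chebyshevT R n) (chebyshevV R n) (n%:R)%:P => T V c.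
by ring.
Qed.

Lemma chebyshev1 (R : comNzRingType) (n : nat) : (chebyshevT R n).[1] = 1.
Proof.
elim: n => [|n IH]; first by rewrite hornerC.
by rewrite chebyshevS !hornerE IH /= expr1n subrr mul0r subr0.
Qed.

Lemma chebyshevV1 (R : comNzRingType) (n : nat) : (chebyshevV R n).[1] = n%:R.
Proof.
elim: n => [|n IH]; first by rewrite horner0.
by rewrite /= !hornerE IH chebyshev1 natr1.
Qed.

Lemma size_chebyshev (R : comNzRingType) (n : nat) :
  (size (chebyshevT R n) <= n.+1)%N.
Proof.
suff: (size (chebyshevT R n) <= n.+1)%N /\ (size (chebyshevT R n.+1) <= n.+2)%N.
  by case.
elim: n => [|n [IH0 IH1]]; first by rewrite /= size_poly1 size_polyX.
split=> //; rewrite [chebyshevT R n.+2]/= -/(chebyshevT R n.+1).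
apply: leq_trans (size_polyD _ _) _; rewrite geq_max size_polyN.
apply/andP; split; last by apply: leq_trans IH0 _; rewrite leqW.
apply: leq_trans (size_scale_leq _ _) _.
by apply: leq_trans (size_polyMleq _ _) _; rewrite size_polyX.
Qed.

Lemma chebyshevN (R : comNzRingType) (n : nat) (x : R) :
  (chebyshevT R n).[- x] = (-1) ^+ n * (chebyshevT R n).[x] /\
  (chebyshevV R n).[- x] = - (-1) ^+ n * (chebyshevV R n).[x].
Proof.
elim: n => [|n [IHT IHV]].
  by rewrite /= !hornerE.
by rewrite chebyshevS /= !hornerE IHT IHV [(-1) ^+ n.+1]exprS; split; ring.
Qed.

Section Schur.
Variable R : realType.
Implicit Types (n k : nat) (s : R).

Lemma chebyshev_le1 n s : -1 <= s <= 1 -> `|(chebyshevT R n).[s]| <= 1.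
Proof.
by move=> s1; rewrite chebyshev_cos// ler_norml cos_geN1 cos_le1.
Qed.

Let node_angle n k : R := (k.*2.+1)%:R * (pi / 2) / n%:R.
Definition chebyshev_nodes n : seq R := [seq cos (node_angle n k) | k <- iota 0 n].

Lemma size_chebyshev_nodes n : size (chebyshev_nodes n) = n.
Proof. by rewrite size_map size_iota. Qed.

Lemma node_angle_itv n k : (k < n)%N -> 0 < node_angle n k < pi.
Proof.
move=> kn; have n0 : 0 < n%:R :> R by rewrite ltr0n (leq_trans _ kn).
have p0 := pi_gt0 R.
rewrite /node_angle divr_gt0 ?mulr_gt0 ?divr_gt0//=.
rewrite ltr_pdivrMr// mulrCA ltr_pM2l// ltr_pdivrMr//.
by rewrite -natrM ltr_nat muln2 ltn_Sdouble.
Qed.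

(** The angles are distinct and lie in [0, pi], where cos is injective. *)
Lemma uniq_chebyshev_nodes n : uniq (chebyshev_nodes n).
Proof.
rewrite map_inj_in_uniq ?iota_uniq// => j k.
rewrite !mem_iota /= !add0n => jn kn.
have n0 : n%:R != 0 :> R by rewrite pnatr_eq0 -lt0n (leq_trans _ kn).
have mem i : (i < n)%N -> node_angle n i \in `[0, pi].
  by move=> /node_angle_itv /andP[a0 a1]; rewrite in_itv /= !ltW.
move=> /(cos_inj (mem _ jn) (mem _ kn)); rewrite /node_angle.
move=> /(mulIf (invr_neq0 n0)).
have p0 : pi / 2 != 0 :> R by rewrite gt_eqF// divr_gt0 ?pi_gt0.
move=> /(mulIf p0) /eqP; rewrite eqr_nat eqSS => /eqP.
exact: double_inj.
Qed.

Lemma cos_odd_pihalf k : cos ((k.*2.+1)%:R * (pi / 2)) = 0 :> R.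
Proof.
elim: k => [|k IH]; first by rewrite mul1r cos_pihalf.
have -> : (k.+1.*2.+1)%:R * (pi / 2) = (k.*2.+1)%:R * (pi / 2) + pi :> R.
  by rewrite doubleS -[k.*2.+3%:R]natr1 -[k.*2.+2%:R]natr1; field.
by rewrite cosDpi IH oppr0.
Qed.

Lemma chebyshev_node_in n s : s \in chebyshev_nodes n -> -1 < s < 1.
Proof.
move=> /mapP[k]; rewrite mem_iota => /andP[_]; rewrite add0n => kn ->.
have /andP[a0 a1] := node_angle_itv kn.
have mem x : 0 <= x <= pi -> x \in `[0, pi]%R by rewrite in_itv.
have aI : node_angle n k \in `[0, pi]%R by apply: mem; rewrite !ltW.
have zI : (0 : R) \in `[0, pi] by apply: mem; rewrite lexx ?pi_ge0.
have pI : (pi : R) \in `[0, pi] by apply: mem; rewrite lexx ?pi_ge0.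
rewrite !lt_neqAle cos_geN1 cos_le1 !andbT; apply/andP; split.
  by rewrite -cospi; apply: contraTneq a1 => /(cos_inj pI aI) <-; rewrite ltxx.
by rewrite -cos0; apply: contraTneq a0 => /(cos_inj aI zI) ->; rewrite ltxx.
Qed.

Lemma chebyshev_node_root n s : s \in chebyshev_nodes n ->
  (chebyshevT R n).[s] = 0.
Proof.
move=> sn; have /andP[s0 s1] := chebyshev_node_in sn.
rewrite chebyshev_cos ?ltW//; move: sn => /mapP[k].
rewrite mem_iota => /andP[_]; rewrite add0n => kn ->.
have /andP[a0 a1] := node_angle_itv kn.
rewrite cosK ?in_itv /= ?ltW// /node_angle mulrC divfK ?cos_odd_pihalf//.
by rewrite pnatr_eq0 -lt0n (leq_trans _ kn).
Qed.

(** At a zero of T_n the Pythagorean identity reduces to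
    (1 - s^2) U_(n-1)(s)^2 = 1, and T_n' = n U_(n-1). *)
Lemma deriv_chebyshev_node n s : s \in chebyshev_nodes n ->
  `|(chebyshevT R n)^`().[s]| * Num.sqrt (1 - s ^+ 2) = n%:R.
Proof.
move=> sn; have := congr1 (horner^~ s) (chebyshev_pythagoras R n).
rewrite !hornerE /= chebyshev_node_root// expr0n add0r => e.
rewrite deriv_chebyshev hornerZ normrM normr_nat -mulrA.
rewrite -[X in X * Num.sqrt _]sqrtr_sqr -sqrtrM ?sqr_ge0//.
by rewrite (_ : _ ^+ 2 * _ = 1) ?sqrtr1 ?mulr1// -[RHS]e; ring.
Qed.

Lemma deriv_chebyshev_node_neq0 n s : s \in chebyshev_nodes n ->
  (chebyshevT R n)^`().[s] != 0.
Proof.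
move=> sn; apply/eqP => e; have := deriv_chebyshev_node sn.
rewrite e normr0 mul0r => /eqP; rewrite eq_sym pnatr_eq0 => /eqP n0.
by move: sn; rewrite n0.
Qed.

Lemma one_notin_nodes n : 1 \notin chebyshev_nodes n.
Proof. by apply/negP => /chebyshev_node_in; rewrite ltxx andbF. Qed.

(** Interpolating T_n' at the zeros of T_n and evaluating at 1 gives
    T_n'(1) = sum of 1 / (1 - s), and T_n'(1) = n U_(n-1)(1) = n^2. *)
Lemma sum_inv_nodes n :
  \sum_(s <- chebyshev_nodes n) (1 - s)^-1 = n%:R ^+ 2.
Proof.
have := @lagrange_root_formula R (chebyshevT R n) (chebyshevT R n)^`()
  (chebyshev_nodes n) 1 (uniq_chebyshev_nodes n).
rewrite size_chebyshev_nodes one_notin_nodes size_chebyshev.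
have -> : (size (chebyshevT R n)^`() <= n)%N.
  by apply: leq_trans (size_poly _ _) _; rewrite -subn1 leq_subLR size_chebyshev.
rewrite deriv_chebyshev hornerZ chebyshevV1 -deriv_chebyshev expr2 => ->//.
- rewrite big_seq [RHS]big_seq; apply: eq_bigr => s sn.
  rewrite chebyshev1 mulr1 -[LHS]mul1r -(divff (deriv_chebyshev_node_neq0 sn)).
  by rewrite -mulrA -invfM.
- by apply/allP => s /chebyshev_node_root/rootP.
- by move=> s; exact: deriv_chebyshev_node_neq0.
Qed.

Import ComplexField.Normc.

Lemma normc_ge0 (z : R[i]) : 0 <= normc z.
Proof. by case: z => a b; exact: sqrtr_ge0. Qed.

Lemma normc_real s : normc s%:C = `|s|.
Proof. by rewrite /= expr0n addr0 sqrtr_sqr. Qed.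

Lemma normc_sum (I : Type) (r : seq I) (F : I -> R[i]) :
  normc (\sum_(i <- r) F i) <= \sum_(i <- r) normc (F i).
Proof.
elim/big_ind2 : _ => // [|z x w y zx wy]; first by rewrite normc0.
by apply: le_trans (le_normcD _ _) (lerD zx wy).
Qed.

(** In the interpolation formula for h(1) at the zeros of T_n, the weight of
    h(s) has modulus sqrt (1 - s^2) / (n (1 - s)).  The factor sqrt (1 - s^2) is
    absorbed by the hypothesis, and the remaining 1 / (1 - s) sum to n^2. *)
Lemma schur_inequality_at1 n (h : {poly R[i]}) (M : R) :
  (size h <= n)%N ->
  (forall s, -1 <= s <= 1 -> Num.sqrt (1 - s ^+ 2) * normc h.[s%:C] <= M) ->
  normc h.[1] <= n%:R * M.
Proof.
case: n => [|n].
  by rewrite leqn0 size_poly_eq0 => /eqP -> _; rewrite horner0 normc0 mul0r.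
set N := n.+1 => szh hM.
pose p := map_poly (real_complex R) (chebyshevT R N).
pose C_nodes := [seq s%:C | s <- chebyshev_nodes N].
have p' s : p^`().[s%:C] = ((chebyshevT R N)^`().[s])%:C.
  by rewrite deriv_map horner_map.
have := @lagrange_root_formula _ p h C_nodes 1.
rewrite map_inj_uniq ?uniq_chebyshev_nodes; last exact: complexI.
rewrite size_map size_chebyshev_nodes szh size_map_poly size_chebyshev.
have -> : p.[1] = 1.
  have -> : (1 : R[i]) = (1 : R)%:C by [].
  by rewrite horner_map chebyshev1.
move=> -> //; last first.
- apply/mapP => -[s sn] /(congr1 (@complex.Re R)) /= e.
  by have := one_notin_nodes N; rewrite e sn.
- move=> _ /mapP[s sn ->]; rewrite p'.
  by apply: contra_neq (deriv_chebyshev_node_neq0 sn) => /complexI.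
- apply/allP => _ /mapP[s sn ->]; apply/rootP.
  by rewrite horner_map chebyshev_node_root// rmorph0.
apply: le_trans (normc_sum _ _) _; rewrite big_map.
have N0 : N%:R != 0 :> R by rewrite pnatr_eq0.
have -> : N%:R * M = \sum_(s <- chebyshev_nodes N) M / N%:R * (1 - s)^-1.
  by rewrite -big_distrr /= sum_inv_nodes expr2 mulrA mulfVK// mulrC.
rewrite big_seq [leRHS]big_seq; apply: ler_sum => s sn.
have /andP[s0 s1] := chebyshev_node_in sn.
have d0 := deriv_chebyshev_node_neq0 sn.
have -> : 1 - s%:C = (1 - s)%:C by rewrite rmorphB.
rewrite mulr1 p' -rmorphM normcM normcV normc_real normrM.
rewrite [`|1 - s|]ger0_norm ?subr_ge0 ?(ltW s1)// invfM mulrA.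
rewrite ler_wpM2r ?invr_ge0 ?subr_ge0 ?(ltW s1)//.
have := hM s; rewrite (ltW s0) (ltW s1) => /(_ isT).
rewrite -(deriv_chebyshev_node sn).
set q := Num.sqrt _; set d := `|_|; set H := normc _ => qH.
have dp : 0 < d by rewrite normr_gt0.
have qp : 0 < q.
  by rewrite sqrtr_gt0 subr_gt0 -real_normK ?num_real// expr_lt1// ltr_norml s0.
rewrite invfM mulrA mulrAC ler_wpM2r ?invr_ge0 ?(ltW dp)//.
by rewrite ler_pdivlMr// mulrC.
Qed.

End Schur.

(** * Directional derivatives and Bernstein's inequality on an ellipse *)

(** To prove a statement about polynomials of total degree at most n, build
    them from 1 by linear combinations at fixed n and by multiplication by a
    variable, which raises n by one. *)
Lemma mpoly_degree_ind (F : comNzRingType) (m : nat)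
    (Q : nat -> {mpoly F[m]} -> Prop) :
  (forall n, Q n 0) -> (forall n, Q n 1) ->
  (forall n c p q, Q n p -> Q n q -> Q n (c *: p + q)) ->
  (forall n i p, Q n p -> Q n.+1 ('X_i * p)) ->
  forall n p, (msize p <= n.+1)%N -> Q n p.
Proof.
move=> Q0 Q1 Qlin QX n p szp.
have Qmon : forall d (mon : 'X_{1..m}) k,
    mdeg mon = d -> (d <= k)%N -> Q k 'X_[mon].
  elim=> [|d IH] mon k.
    by move=> /eqP; rewrite mdeg_eq0 => /eqP -> _; rewrite mpolyX0.
  case: k => // k degm dk.
  have [i mi] : exists i, mon i != 0%N.
    apply/existsP; apply: contra_eqT degm => /existsPn mon0.
    by rewrite mdegE big1 // => i _; apply/eqP; rewrite -[_ == _]negbK mon0.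
  have monE : mon = (U_(i) + (mon - U_(i)))%MM by rewrite addmC submK // lep1mP.
  rewrite monE mpolyXD; apply/QX/IH => //.
  by move: degm; rewrite {1}monE mdegD mdeg1 => -[].
rewrite (mpolyE p) big_seq.
elim/big_rec: _ => // mon q /msize_mdeg_lt mp IH.
by apply: Qlin => //; apply: (Qmon _ mon _ erefl); rewrite -ltnS (leq_trans mp).
Qed.

Section Bernstein.
Variables (R : realType) (m : nat).
Implicit Types (P Q : {mpoly R[i][m]}) (x z w t : 'rV[R]_m).
Import ComplexField.Normc.

Lemma peval0 x : peval (0 : {mpoly R[i][m]}) x = 0.
Proof. exact: meval0. Qed.

Lemma peval1 x : peval (1 : {mpoly R[i][m]}) x = 1.
Proof. exact: meval1. Qed.

Lemma pevalZ c P x : peval (c *: P) x = c * peval P x.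
Proof. exact: mevalZ. Qed.

Lemma pevalD P Q x : peval (P + Q) x = peval P x + peval Q x.
Proof. exact: mevalD. Qed.

Lemma pevalM P Q x : peval (P * Q) x = peval P x * peval Q x.
Proof. exact: mevalM. Qed.

Lemma pevalX i x : peval 'X_i x = (x 0 i)%:C.
Proof. exact: mevalXU. Qed.

Definition dirderiv w P z : R[i] := cdot w (gradient P z).

Lemma dirderivE w P z : dirderiv w P z = \sum_j (w 0 j)%:C * peval P^`M(j) z.
Proof. by apply: eq_bigr => j _; rewrite mxE. Qed.

Lemma dirderivD w P Q z :
  dirderiv w (P + Q) z = dirderiv w P z + dirderiv w Q z.
Proof.
rewrite !dirderivE -big_split /=; apply: eq_bigr => j _.
by rewrite mderivD pevalD mulrDr.
Qed.

Lemma dirderivZ w c P z : dirderiv w (c *: P) z = c * dirderiv w P z.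
Proof.
rewrite !dirderivE mulr_sumr; apply: eq_bigr => j _.
by rewrite mderivZ pevalZ mulrCA.
Qed.

Lemma dirderiv0 w z : dirderiv w 0 z = 0.
Proof. by rewrite -(scale0r 0) dirderivZ mul0r. Qed.

Lemma dirderivC w c z : dirderiv w c%:MP z = 0.
Proof.
by rewrite dirderivE big1 // => j _; rewrite mderivC peval0 mulr0.
Qed.

Lemma dirderivM w P Q z :
  dirderiv w (P * Q) z = dirderiv w P z * peval Q z + peval P z * dirderiv w Q z.
Proof.
rewrite !dirderivE mulr_suml mulr_sumr -big_split /=; apply: eq_bigr => j _.
rewrite mderivM pevalD !pevalM.
move: (peval P^`M(j) z) (peval Q^`M(j) z) (peval P z) (peval Q z) => p' q' p q.
by ring.
Qed.

Lemma dirderivX w i z : dirderiv w 'X_i z = (w 0 i)%:C.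
Proof.
rewrite dirderivE (bigD1 i) //= big1 => [|j ji].
  rewrite mderivX mnm1E eqxx scale1r -[X in (X - _)%MM]add0m addmK mpolyX0.
  by rewrite peval1 mulr1 addr0.
by rewrite mderivX mnm1E eq_sym (negPf ji) scale0r peval0 mulr0.
Qed.

Lemma dirderivZl c w P z : dirderiv (c *: w) P z = c%:C * dirderiv w P z.
Proof.
by rewrite !dirderivE mulr_sumr; apply: eq_bigr => j _; rewrite mxE rmorphM mulrA.
Qed.

Lemma size_poly_lin (F : comNzRingType) (n : nat) c (p q : {poly F}) :
  (size p <= n)%N -> (size q <= n)%N -> (size (c *: p + q)%R <= n)%N.
Proof.
move=> sp sq; apply: leq_trans (size_polyD _ _) _; rewrite geq_max sq andbT.
exact: leq_trans (size_scale_leq _ _) sp.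
Qed.

Lemma size_mulX_leq (F : comNzRingType) (n : nat) (p : {poly F}) :
  (size p <= n)%N -> (size ('X * p)%R <= n.+1)%N.
Proof.
by move=> sp; apply: leq_trans (size_polyMleq _ _) _; rewrite size_polyX.
Qed.

(** On the circle, s^2 is a polynomial in c, so each polynomial in (c, s) is
    A(c) + s h(c), and multiplication by a variable c z_i + s w_i acts on such
    pairs without raising the degree by more than one.  The value h(1) is the
    derivative of the curve at its vertex z, where c = 1 and s = 0. *)
Lemma elliptic_decomposition n P z w : poly_space n P ->
  exists A h : {poly R[i]}, [/\ (size A <= n.+1)%N, (size h <= n)%N,
    forall c s : R, s ^+ 2 = 1 - c ^+ 2 ->
      peval P (c *: z + s *: w) = A.[c%:C] + s%:C * h.[c%:C] &
    dirderiv w P z = h.[1]].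
Proof.
move: n P; apply: mpoly_degree_ind.
- move=> n; exists 0, 0; rewrite size_poly0; split=> //.
    by move=> c s _; rewrite peval0 !horner0 mulr0 addr0.
  by rewrite dirderiv0 horner0.
- move=> n; exists 1%:P, 0; rewrite size_poly0; split=> [||c s _|].
  + exact: leq_trans (size_polyC_leq1 _) _.
  + by [].
  + by rewrite peval1 horner0 hornerC mulr0 addr0.
  by rewrite -mpolyC1 dirderivC horner0.
- move=> n a p q [A [h [sA sh eP dP]]] [B [g [sB sg eQ dQ]]].
  exists (a *: A + B), (a *: h + g).
  rewrite !size_poly_lin //; split=> // [c s sc|].
    rewrite pevalD pevalZ eP // eQ // !hornerD !hornerZ.
    ring.
  by rewrite dirderivD dirderivZ dP dQ hornerD hornerZ.
move=> n i p [A [h [sA sh eP dP]]].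
exists ((z 0 i)%:C *: ('X * A) + ((w 0 i)%:C *: (h - 'X * ('X * h)))),
  ((z 0 i)%:C *: ('X * h) + (w 0 i)%:C *: A); split.
- apply: size_poly_lin; first exact: size_mulX_leq.
  apply: leq_trans (size_scale_leq _ _) _.
  apply: leq_trans (size_polyD _ _) _; rewrite geq_max size_polyN.
  by rewrite !size_mulX_leq// (leq_trans sh)// leqW.
- apply: size_poly_lin; first exact: size_mulX_leq.
  exact: leq_trans (size_scale_leq _ _) sA.
- move=> c s sc; rewrite pevalM pevalX eP // !mxE rmorphD !rmorphM /=.
  have : s%:C ^+ 2 = 1 - c%:C ^+ 2 :> R[i].
    by rewrite -!rmorphXn /= sc rmorphB rmorph1.
  rewrite !(hornerD, hornerN, hornerZ, hornerM, hornerX).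
  move: (s%:C) (c%:C) ((z 0 i)%:C) ((w 0 i)%:C) => S C Z W e.
  transitivity (C * Z * A.[C] + S * Z * C * h.[C] + S * W * A.[C]
                + S ^+ 2 * W * h.[C]).
    by ring.
  by rewrite e; ring.
rewrite dirderivM dirderivX pevalX dP hornerD !hornerZ hornerM hornerX.
have := eP 1 0; rewrite expr0n expr1n subrr scale1r scale0r addr0 => -> //.
by rewrite rmorph0 mul0r addr0 rmorph1; ring.
Qed.

(** The restriction g of P to the line is carried along with f because the
    product rule brings it in; its degree bound is one larger. *)
Lemma radial_derivative n P x w : poly_space n P ->
  exists f : {poly R[i]}, (size f <= n)%N /\
    forall s : R, dirderiv w P (s *: x) = f.[s%:C].
Proof.
move=> Pn; suff [g [f [_ sf _ fE]]] : exists g f : {poly R[i]},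
    [/\ (size g <= n.+1)%N, (size f <= n)%N,
     forall s : R, peval P (s *: x) = g.[s%:C] &
     forall s : R, dirderiv w P (s *: x) = f.[s%:C]] by exists f.
move: n P Pn; apply: mpoly_degree_ind.
- move=> n; exists 0, 0; rewrite size_poly0; split=> // s.
    by rewrite peval0 horner0.
  by rewrite dirderiv0 horner0.
- move=> n; exists 1%:P, 0; rewrite size_poly0; split=> [||s|s].
  + exact: leq_trans (size_polyC_leq1 _) _.
  + by [].
  + by rewrite peval1 hornerC.
  by rewrite -mpolyC1 dirderivC horner0.
- move=> n a p q [g [f [sg sf gE fE]]] [g' [f' [sg' sf' gE' fE']]].
  exists (a *: g + g'), (a *: f + f'); rewrite !size_poly_lin //.
  split=> // s; first by rewrite pevalD pevalZ gE gE' hornerD hornerZ.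
  by rewrite dirderivD dirderivZ fE fE' hornerD hornerZ.
move=> n i p [g [f [sg sf gE fE]]].
exists ((x 0 i)%:C *: ('X * g)), ((x 0 i)%:C *: ('X * f) + (w 0 i)%:C *: g); split.
- by apply: leq_trans (size_scale_leq _ _) _; exact: size_mulX_leq.
- apply: size_poly_lin; first exact: size_mulX_leq.
  exact: leq_trans (size_scale_leq _ _) sg.
- move=> s; rewrite pevalM pevalX gE mxE rmorphM hornerZ hornerM hornerX.
  by rewrite mulrA [s%:C * _]mulrC.
move=> s; rewrite dirderivM dirderivX pevalX fE gE mxE rmorphM.
by rewrite hornerD !hornerZ hornerM hornerX; ring.
Qed.

Lemma peval_bounded P (B : R) : exists D : R, forall x,
  (forall j, `|x 0 j| <= B) -> normc (peval P x) <= D.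
Proof.
have [n] : exists n, (msize P <= n.+1)%N by exists (msize P).
move: n P; apply: mpoly_degree_ind => n.
- by exists 0 => x _; rewrite peval0 normc0.
- by exists 1 => x _; rewrite peval1 normc1.
- move=> c p q [D pD] [E qE]; exists (normc c * D + E) => x xB.
  rewrite pevalD pevalZ; apply: le_trans (le_normcD _ _) _.
  by rewrite normcM lerD ?qE// ler_wpM2l ?normc_ge0 ?pD.
move=> i p [D pD]; exists (B * D) => x xB.
by rewrite pevalM pevalX normcM ler_pM ?normc_ge0 ?pD// normc_real.
Qed.

(** The part of P(c z + s w) that is odd in s is s h(c), bounded by B, and
    s = sqrt (1 - c^2); Schur's inequality turns this into a bound on h(1). *)
Lemma bernstein_on_ellipse n P z w (B : R) : poly_space n P ->
  (forall c s : R, s ^+ 2 = 1 - c ^+ 2 -> normc (peval P (c *: z + s *: w)) <= B) ->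
  normc (dirderiv w P z) <= n%:R * B.
Proof.
move=> Pn PB; have [A [h [_ sh eP ->]]] := elliptic_decomposition z w Pn.
apply: schur_inequality_at1 => // c c1.
set s := Num.sqrt _.
have s2 : s ^+ 2 = 1 - c ^+ 2.
  by rewrite sqr_sqrtr// subr_ge0 -real_normK ?num_real// expr_le1// ler_norml.
have s2N : (- s) ^+ 2 = 1 - c ^+ 2 by rewrite sqrrN.
have odd_part : peval P (c *: z + s *: w) - peval P (c *: z + (- s) *: w)
    = (2 * s)%:C * h.[c%:C].
  rewrite !eP// rmorphN rmorphM /= rmorph_nat.
  by ring.
have : normc ((2 * s)%:C * h.[c%:C]) <= B + B.
  rewrite -odd_part; apply: le_trans (le_normcD _ _) _.
  by rewrite normcN lerD ?PB.
rewrite normcM normc_real ger0_norm ?mulr_ge0 ?sqrtr_ge0//.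
by lra.
Qed.

End Bernstein.

(** * Symmetric convex bodies and their polars *)

Section Geometry.
Variables (R : realType) (m : nat).
Implicit Types (t x y a u : 'rV[R]_m) (K V W : set 'rV[R]_m).

Lemma dotC x y : dot x y = dot y x.
Proof. by apply: eq_bigr => j _; rewrite mulrC. Qed.

Lemma dotDr a x y : dot a (x + y) = dot a x + dot a y.
Proof. by rewrite -big_split; apply: eq_bigr => j _; rewrite mxE mulrDr. Qed.

Lemma dotZr a c x : dot a (c *: x) = c * dot a x.
Proof. by rewrite mulr_sumr; apply: eq_bigr => j _; rewrite mxE mulrCA. Qed.

Lemma dotNr a x : dot a (- x) = - dot a x.
Proof. by rewrite -scaleN1r dotZr mulN1r. Qed.

Lemma dotBr a x y : dot a (x - y) = dot a x - dot a y.
Proof. by rewrite dotDr dotNr. Qed.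

Lemma dot_sqrB x y : dot (x - y) (x - y) = dot x x - 2 * dot y x + dot y y.
Proof. by rewrite dotBr !(dotC (x - y)) !dotBr (dotC x y); ring. Qed.

Lemma dot0r a : dot a 0 = 0.
Proof. by rewrite -(scale0r 0) dotZr mul0r. Qed.

Lemma dot_gt0 x : x != 0 -> 0 < dot x x.
Proof.
move=> x0; have sq_ge0 j : 0 <= x 0 j * x 0 j by rewrite -expr2 sqr_ge0.
rewrite lt_neqAle sumr_ge0 // andbT eq_sym; apply: contra x0.
rewrite psumr_eq0 // => /allP x0; apply/eqP/rowP => j; rewrite mxE.
by have := x0 j; rewrite mem_index_enum => /(_ isT); rewrite mulf_eq0 orbb => /eqP.
Qed.

Lemma dot_delta x j : dot x (delta_mx 0 j) = x 0 j.
Proof.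
rewrite /dot (bigD1 j) //= mxE !eqxx mulr1 big1 ?addr0 // => i ij.
by rewrite mxE (negPf ij) andbF mulr0.
Qed.

Lemma dot_le (B : R) t x :
  (forall j, `|t 0 j| <= B) -> `|dot t x| <= B * \sum_j `|x 0 j|.
Proof.
move=> tB; rewrite mulr_sumr; apply: le_trans (ler_norm_sum _ _ _) _.
by apply: ler_sum => j _; rewrite normrM ler_wpM2r.
Qed.

Lemma dot_continuous (T : topologicalType) (f g : T -> 'rV[R]_m) :
  continuous f -> continuous g -> continuous (fun p => dot (f p) (g p)).
Proof.
move=> cf cg; apply: continuous_big => [|j _]; first exact: add_continuous.
have coord (h : T -> 'rV[R]_m) : continuous h -> continuous (fun p => h p 0 j).
  move=> ch p; apply: (@continuous_comp _ _ _ h (fun v : 'rV[R]_m => v 0 j)).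
    exact: ch.
  exact: coord_continuous.
by move=> p; apply: cvgM; [exact: coord cf p|exact: coord cg p].
Qed.

Lemma norm_dot_continuous (T : topologicalType) (f g : T -> 'rV[R]_m) :
  continuous f -> continuous g -> continuous (fun p => `|dot (f p) (g p)|).
Proof. by move=> cf cg p; exact: (cvg_norm (@dot_continuous _ _ _ cf cg p)). Qed.

Definition coord_bounded (B : R) W := forall x, W x -> forall j, `|x 0 j| <= B.
Definition contains_cube (r : R) W := forall x, (forall j, `|x 0 j| <= r) -> W x.

Lemma convex_segment V x y (s : R) : convex_set V -> V x -> V y ->
  0 <= s <= 1 -> V (s *: x + (1 - s) *: y).
Proof.
move=> cV Vx Vy /andP[s0 s1].
have := cV x y (Itv01 s0 s1); rewrite !inE => /(_ Vx Vy).
by [].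
Qed.

(** Symmetry and convexity give c z in V for |c| <= 1; the combination is then
    the convex combination with weights |a| and 1 - |a| of two such points. *)
Lemma symmetric_convex_combination V x y (a b : R) :
  convex_set V -> origin_symmetric V -> V x -> V y ->
  `|a| + `|b| <= 1 -> V (a *: x + b *: y).
Proof.
move=> cV sV Vx Vy ab.
have scale z (c : R) : V z -> `|c| <= 1 -> V (c *: z).
  move=> Vz; rewrite ler_norml => /andP[c0 c1].
  have -> : c *: z = ((1 + c) / 2) *: z + (1 - (1 + c) / 2) *: (- z).
    by rewrite scalerN -scalerBl; congr (_ *: _); field.
  by apply: convex_segment => //; [exact: sV|apply/andP; split; lra].
have [a0|a0] := eqVneq a 0.
  by rewrite a0 scale0r add0r; apply: scale => //; move: ab; rewrite a0 normr0 add0r.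
have [a1|a1] := eqVneq `|a| 1.
  have -> : b = 0.
    by apply/eqP; rewrite -normr_le0; move: ab; rewrite a1; lra.
  by rewrite scale0r addr0; apply: scale => //; rewrite a1.
have Na0 : `|a| != 0 by rewrite normr_eq0.
have ale1 : `|a| < 1.
  by rewrite lt_neqAle a1; have := normr_ge0 b; lra.
have N1 : 1 - `|a| != 0 by rewrite subr_eq0 eq_sym.
have -> : a *: x + b *: y =
    `|a| *: ((a / `|a|) *: x) + (1 - `|a|) *: ((b / (1 - `|a|)) *: y).
  by rewrite !scalerA; congr (_ *: _ + _ *: _); field.
apply: convex_segment => //; last by rewrite normr_ge0 ltW.
  by apply: scale => //; rewrite normrM normrV ?unitfE// normr_id divff.
apply: scale => //; rewrite normrM normrV ?unitfE// [X in _ / X]ger0_norm.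
  by rewrite ler_pdivrMr ?subr_gt0// mul1r; lra.
by rewrite subr_ge0 ltW.
Qed.

Lemma compact_coord_bounded V : compact V ->
  exists2 B : R, 0 < B & coord_bounded B V.
Proof.
move=> /compact_bounded /ex_strict_bound_gt0 [B B0 VB].
exists B => // x /VB /= /ltW xB j; apply: le_trans xB.
rewrite [leRHS]/Num.norm /= mx_normrE.
by apply/bigmax_geP; right => /=; exists (0, j).
Qed.

Lemma interior_coord W x : W° x <-> exists2 e : R, 0 < e &
  forall y, (forall j, `|x 0 j - y 0 j| < e) -> W y.
Proof.
split=> [/nbhs_ballP[e /= e0 eW]|[e e0 eW]].
  by exists e => // y xy; apply: eW; split=> // i j; rewrite ord1; exact: xy.
by apply/nbhs_ballP; exists e => // y [_ xy]; apply: eW => j; exact: xy.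
Qed.

(** With p interior, x is the midpoint of p + 2 x and - p, and both are in V
    when x is small. *)
Lemma body_contains_cube V : convex_body V -> origin_symmetric V ->
  exists2 r : R, 0 < r & contains_cube r V.
Proof.
move=> [_ cV [p /[dup] /interior_subset Vp /interior_coord[e e0 eV]]] sV.
exists (e / 4); first by lra.
move=> x xe.
have -> : x = (1 / 2) *: (p + 2 *: x) + (1 - 1 / 2) *: (- p).
  by apply/rowP => j; rewrite !mxE; field.
apply: convex_segment => //; [|exact: sV|by apply/andP; split; lra].
apply: eV => j; rewrite !mxE opprD addNKr normrN normrM ger0_norm //.
by have := xe j; lra.
Qed.

Lemma polar0 V : polar V 0.
Proof. by move=> t _; rewrite dot0r normr0. Qed.

(** Pairing y with the point of V at distance r on the j-th axis bounds the
    j-th coordinate of y. *)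
Lemma polar_coord_bounded V (r : R) : 0 < r ->
  contains_cube r V -> coord_bounded r^-1 (polar V).
Proof.
move=> r0 rV y Vy j; have := Vy (r *: delta_mx 0 j).
rewrite dotC dotZr dot_delta normrM gtr0_norm // => h.
rewrite -[r^-1]mul1r ler_pdivlMr // mulrC; apply: h.
apply: rV => i; rewrite !mxE eqxx /= normrM gtr0_norm // normr_nat.
by case: (i == j); rewrite ?mulr1 // mulr0 ltW.
Qed.

Lemma polar_contains_cube V (B : R) : (0 < m)%N -> 0 < B ->
  coord_bounded B V -> contains_cube (B * m%:R)^-1 (polar V).
Proof.
move=> m0 B0 VB y yr t /VB tB; apply: le_trans (dot_le _ tB) _.
have mR : 0 < m%:R :> R by rewrite ltr0n.
have -> : 1 = B * \sum_(j < m) (B * m%:R)^-1.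
  rewrite sumr_const card_ord -[(_^-1) *+ _]mulr_natr.
  by field; rewrite !gt_eqF.
by rewrite ler_pM2l // ler_sum.
Qed.

Lemma polar_closed V : closed (polar V).
Proof.
have -> : polar V = \bigcap_(t in V) (fun y => `|dot t y|) @^-1` [set s | s <= 1].
  by rewrite eqEsubset; split.
apply: closed_bigI => t _; apply: preimage_closed; last exact: closed_le.
move=> y _; apply: (norm_dot_continuous (f := fun=> t) (g := id)).
  exact: cst_continuous.
by move=> z.
Qed.

Lemma polar_compact V (r : R) : 0 < r -> contains_cube r V -> compact (polar V).
Proof.
move=> r0 rV; apply: bounded_closed_compact (@polar_closed V).
exists r^-1; split; first exact: num_real.
move=> M rM y /(polar_coord_bounded r0 rV) yr.
rewrite /= [leLHS]/Num.norm /= mx_normrE; apply/bigmax_leP; split=> [|[i j] _ /=].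
  by apply: le_trans (ltW rM); rewrite invr_ge0 ltW.
by rewrite ord1; apply: le_trans (yr j) (ltW rM).
Qed.

Lemma EVT_max_set (T : topologicalType) (f : T -> R) (A : set T) :
  A !=set0 -> compact A -> continuous f ->
  exists2 c, A c & forall p, A p -> f p <= f c.
Proof.
move=> A0 cA cf.
have [c] := compact_EVT_max A0 cA (continuous_subspaceT cf).
by rewrite inE => Ac fc; exists c => // p Ap; apply: fc; rewrite inE.
Qed.

(** If t is outside V, the point v of V nearest to t gives u = t - v with
    (u, x) <= (u, v) < (u, t) on V.  By symmetry |(u, .)| <= (u, v) on V, so u
    divided by a number strictly between (u, v) and (u, t) is in the polar of
    V, and pairs with t to more than 1. *)
Lemma bipolar V t : convex_body V -> origin_symmetric V ->
  polar (polar V) t -> V t.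
Proof.
move=> [cptV cV [p /interior_subset Vp]] sV Vt; apply: contrapT => nVt.
pose f v := - dot (v - t) (v - t).
have cf : continuous f.
  have cB : continuous (fun v : 'rV[R]_m => v - t).
    by move=> v; exact: (cvgB cvg_id (cvg_cst t)).
  by move=> v; exact: (cvgN (@dot_continuous _ _ _ cB cB v)).
have [v Vv vmax] := EVT_max_set (ex_intro _ p Vp) cptV cf.
pose u := t - v.
have u0 : u != 0 by rewrite subr_eq0; apply: contra_notN nVt => /eqP ->.
(* Otherwise moving from v towards x by the fraction s decreases the distance
   to t: its square changes by s (s e - 2 g) < 0. *)
have sep x : V x -> dot u x <= dot u v.
  move=> Vx; rewrite leNgt; apply/negP => uvx.
  pose d := x - v; pose g := dot u d; pose e := dot d d.
  have g0 : 0 < g by rewrite /g dotBr subr_gt0.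
  have e0 : 0 <= e by apply: sumr_ge0 => j _; rewrite -expr2 sqr_ge0.
  pose s := g / (e + g).
  have eg : 0 < e + g by lra.
  have s0 : 0 < s by rewrite divr_gt0.
  have s1 : s <= 1 by rewrite ler_pdivrMr //; lra.
  have := vmax _ (convex_segment cV Vx Vv (_ : 0 <= s <= 1)).
  rewrite ltW// => /(_ s1); rewrite /f.
  have -> : s *: x + (1 - s) *: v - t = s *: d - u.
    by apply/rowP => j; rewrite !mxE; ring.
  have -> : v - t = - u by rewrite opprB.
  rewrite dot_sqrB dotNr [dot (- u) u]dotC dotNr opprK !dotZr.
  rewrite [dot (s *: d) d]dotC dotZr -/g -/e.
  have se : s * e < g.
    by rewrite mulrAC ltr_pdivrMr // ltr_pM2l //; lra.
  have : s * (s * e) < s * g by rewrite ltr_pM2l.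
  have := mulr_gt0 s0 g0.
  lra.
pose h := dot u v; pose q := dot u u.
have q0 : 0 < q by exact: dot_gt0.
have usym x : V x -> `|dot u x| <= h.
  move=> Vx; rewrite ler_norml sep // andbT lerNl -dotNr; apply: sep; exact: sV.
have h0 : 0 <= h by apply: le_trans (usym _ Vv).
have c0 : 0 < h + q / 2 by lra.
have ut : dot u t = h + q by rewrite -dotDr [v + u]addrC subrK.
have /Vt : polar V ((h + q / 2)^-1 *: u).
  move=> x Vx; rewrite dotZr normrM gtr0_norm ?invr_gt0// dotC mulrC.
  by rewrite ler_pdivrMr// mul1r; have := usym x Vx; lra.
rewrite dotC dotZr dotC ut => /ler_normlW; rewrite mulrC ler_pdivrMr // mul1r.
by lra.
Qed.

End Geometry.

(** * The norms as attained suprema *)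

Section Norms.
Variables (R : realType) (m : nat).
Implicit Types (t x y a u : 'rV[R]_m) (K V W : set 'rV[R]_m).
Import ComplexField.Normc.

Lemma sup_ge (T : Type) (A : set T) (f : T -> R) (B : R) (p : T) :
  (forall q, A q -> f q <= B) -> A p -> f p <= sup [set f q | q in A].
Proof.
move=> fB Ap; apply: ub_le_sup; last by exists p.
by exists B => _ [q Aq <-]; exact: fB.
Qed.

Lemma sup_le (T : Type) (A : set T) (f : T -> R) (B : R) :
  A !=set0 -> (forall q, A q -> f q <= B) -> sup [set f q | q in A] <= B.
Proof.
move=> [p Ap] fB; apply: ge_sup; first by exists (f p), p.
by move=> _ [q Aq <-]; exact: fB.
Qed.

Section BoundedPolar.
Variables (K : set 'rV[R]_m) (B : R).
Hypothesis KB : coord_bounded B (polar K).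

Lemma rnorm_ge t x : polar K t -> `|dot t x| <= rnorm K x.
Proof.
by apply: (@sup_ge _ _ (fun t => `|dot t x|)) => s /KB; exact: dot_le.
Qed.

Lemma rnorm_le x (c : R) : (forall t, polar K t -> `|dot t x| <= c) ->
  rnorm K x <= c.
Proof. by apply: sup_le; exists 0; exact: polar0. Qed.

Lemma cnorm_le (z : 'rV[R[i]]_m) (c : R) :
  (forall t, polar K t -> normc (cdot t z) <= c) -> cnorm K z <= c.
Proof. by apply: sup_le; exists 0; exact: polar0. Qed.

Lemma cnorm_ge t (z : 'rV[R[i]]_m) : polar K t -> normc (cdot t z) <= cnorm K z.
Proof.
apply: (@sup_ge _ _ (fun t => normc (cdot t z)) (B * \sum_j normc (z 0 j))).
move=> s /KB sB; apply: le_trans (normc_sum _ _) _; rewrite mulr_sumr.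
by apply: ler_sum => j _; rewrite normcM normc_real ler_wpM2r ?normc_ge0.
Qed.

(** A complex vector of the form c a with a real has norm |c| times the norm
    of a; the hypothesis says this through the pairings with real vectors. *)
Lemma cnorm_real_multiple (z : 'rV[R[i]]_m) (c : R[i]) a :
  (forall t, cdot t z = c * (dot t a)%:C) -> cnorm K z = normc c * rnorm K a.
Proof.
move=> zE; apply/le_anti/andP; split.
  apply: cnorm_le => t Kt; rewrite zE normcM normc_real.
  by rewrite ler_wpM2l ?normc_ge0// rnorm_ge.
have [c0|c0] := eqVneq (normc c) 0.
  by rewrite c0 mul0r; apply: le_trans (cnorm_ge _ (@polar0 _ _ K)); exact: normc_ge0.
have cp : 0 < normc c by rewrite lt_neqAle eq_sym c0 normc_ge0.
rewrite mulrC -ler_pdivlMr//; apply: rnorm_le => t Kt.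
by rewrite ler_pdivlMr// mulrC -normc_real -normcM -zE cnorm_ge.
Qed.

Lemma maxnorm_ge (D : R) W y : coord_bounded D W -> W y ->
  rnorm K y <= maxnorm K W.
Proof.
move=> WD; apply: (@sup_ge _ _ (rnorm K) (\sum_(j < m) `|B| * D)) => x Wx.
apply: rnorm_le => t Kt.
apply: le_trans (dot_le (B := `|B|) _ _) _.
  by move=> j; apply: le_trans (KB Kt j) (ler_norm _).
by rewrite mulr_sumr; apply: ler_sum => j _; rewrite ler_wpM2l// WD.
Qed.

End BoundedPolar.

(** The maximum is taken jointly over the compact product of the two polars,
    which avoids proving that the norm is continuous. *)
Lemma maxnorm_attained K V (k r : R) :
  0 < k -> contains_cube k K -> 0 < r -> contains_cube r V ->
  exists t a, [/\ polar K t, polar V a, rnorm K a = maxnorm K (polar V) &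
    `|dot t a| = maxnorm K (polar V)].
Proof.
move=> k0 kK r0 rV.
have cpt := compact_setX (polar_compact k0 kK) (polar_compact r0 rV).
have cf : continuous (fun p : 'rV[R]_m * 'rV[R]_m => `|dot p.1 p.2|).
  apply: norm_dot_continuous => q; [exact: cvg_fst|exact: cvg_snd].
have ne : (polar K `*` polar V) !=set0 by exists (0, 0); split; exact: polar0.
have [[t a] /= [Kt Va] mx] := EVT_max_set ne cpt cf.
have KB := polar_coord_bounded k0 kK; have VB := polar_coord_bounded r0 rV.
have le1 : maxnorm K (polar V) <= `|dot t a|.
  apply: sup_le => [|y Vy]; first by exists 0; exact: polar0.
  by apply: rnorm_le => s Ks; exact: (mx (s, y)).
have le2 := rnorm_ge KB a Kt; have le3 := maxnorm_ge KB VB Va.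
exists t, a; split=> //; apply/le_anti; first by rewrite le3 (le_trans le1 le2).
by rewrite le1 (le_trans le2 le3).
Qed.

(** If |(a, x)| < 1 at the maximum over V, then every point close enough to a
    is still in the polar, so a is interior. *)
Lemma boundary_polar_attained V a (B : R) : compact V -> V !=set0 ->
  origin_symmetric V -> 0 < B -> coord_bounded B V ->
  boundary (polar V) a -> exists2 x, V x & dot a x = 1.
Proof.
move=> cptV V0 sV B0 VB [].
rewrite -(proj1 (closure_id _) (@polar_closed _ _ V)) => Va nint.
have cf : continuous (fun x => `|dot x a|).
  apply: (norm_dot_continuous (f := id) (g := fun=> a)); first by move=> ?.
  exact: cst_continuous.
have [x Vx xmax] := EVT_max_set V0 cptV cf.
have [x1|x1] := ltP `|dot x a| 1; last first.
  have xa : `|dot x a| = 1 by apply/le_anti; rewrite x1 Va.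
  have [p|n] := leP 0 (dot x a).
    by exists x => //; rewrite dotC -xa ger0_norm.
  by exists (- x); [exact: sV|rewrite dotNr dotC -xa ltr0_norm].
case: nint; apply/interior_coord.
have m1 : 0 < B * m.+1%:R by rewrite mulr_gt0 // ltr0n.
(* The dimension plus one, so that the radius makes sense for m = 0. *)
exists ((1 - `|dot x a|) / (B * m.+1%:R)); first by rewrite divr_gt0 ?subr_gt0.
move=> y ya s Vs.
have -> : y = a + (y - a) by rewrite addrC subrK.
rewrite dotDr; apply: le_trans (ler_normD _ _) _.
have h1 := xmax _ Vs; have h2 := dot_le (y - a) (VB _ Vs).
suff h3 : B * \sum_j `|(y - a) 0 j| <= 1 - `|dot x a| by lra.
have : \sum_j `|(y - a) 0 j| <= \sum_(j < m) (1 - `|dot x a|) / (B * m.+1%:R).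
  by apply: ler_sum => j _; rewrite !mxE distrC; apply/ltW/ya.
rewrite sumr_const card_ord -[_ *+ m]mulr_natr => h3.
apply: le_trans (ler_wpM2l (ltW B0) h3) _.
have -> : B * ((1 - `|dot x a|) / (B * m.+1%:R) * m%:R)
    = (1 - `|dot x a|) * (m%:R / m.+1%:R).
  by field; rewrite gt_eqF //= gt_eqF // ltr0n.
rewrite -[leRHS]mulr1 ler_wpM2l ?subr_ge0 ?(ltW x1)//.
by rewrite ler_pdivrMr ?ltr0n// mul1r ler_nat.
Qed.

(** A maximizer in the interior of the polar of V could be multiplied by some
    1 + d > 1 without leaving the polar, which would increase its norm. *)
Lemma maxnorm_attained_boundary K V (k r : R) : 
  0 < k -> contains_cube k K -> 0 < r -> contains_cube r V ->
  0 < maxnorm K (polar V) ->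
  exists a, boundary (polar V) a /\ rnorm K a = maxnorm K (polar V).
Proof.
move=> k0 kK r0 rV lam0.
have [t [a [Kt Va aM taM]]] := maxnorm_attained k0 kK r0 rV.
exists a; split=> //; split; first exact: subset_closure.
move=> /interior_coord[e e0 eV].
have KB := polar_coord_bounded k0 kK; have VB := polar_coord_bounded r0 rV.
pose d := e * r / 2.
have d0 : 0 < d by rewrite divr_gt0 ?mulr_gt0.
have /(maxnorm_ge KB VB) : polar V ((1 + d) *: a).
  apply: eV => j; rewrite !mxE mulrDl mul1r opprD addNKr normrN normrM gtr0_norm//.
  have := VB _ Va j; rewrite -(ler_pM2l d0) => /le_lt_trans; apply.
  by rewrite /d mulrAC mulfK ?gt_eqF//; lra.
have := rnorm_ge KB ((1 + d) *: a) Kt.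
rewrite dotZr normrM taM ger0_norm; last by lra.
move=> h1 h2; have := le_trans h1 h2.
by rewrite mulrDl mul1r gerDl leNgt mulr_gt0.
Qed.

End Norms.

(** * Markov's inequality on a symmetric convex body *)

Section MarkovInequality.
Variables (R : realType) (m : nat).
Implicit Types (P : {mpoly R[i][m]}) (t x y a u : 'rV[R]_m) (V : set 'rV[R]_m).
Import ComplexField.Normc.

Lemma peval_le_supnorm V P (B : R) x : coord_bounded B V -> V x ->
  normc (peval P x) <= supnorm V P.
Proof.
move=> VB; have [D PD] := peval_bounded P B.
by apply: (@sup_ge _ _ _ (fun x => normc (peval P x)) D) => y /VB; exact: PD.
Qed.

(** The coefficients of x and y have absolute values summing to at most 1 by
    Cauchy-Schwarz for the unit vectors (c, q) and (s, sqrt (1 - s^2)). *)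
Lemma ellipse_in_convex V x y (s c q : R) : convex_set V -> origin_symmetric V ->
  V x -> V y -> -1 <= s <= 1 -> q ^+ 2 = 1 - c ^+ 2 ->
  V (c *: (s *: x) + q *: (Num.sqrt (1 - s ^+ 2) *: y)).
Proof.
move=> cV sV Vx Vy s1 qc; rewrite !scalerA.
apply: symmetric_convex_combination => //; rewrite !normrM.
set p := Num.sqrt _.
have p2 : `|p| ^+ 2 = 1 - `|s| ^+ 2.
  rewrite !real_normK ?num_real// sqr_sqrtr// subr_ge0 -real_normK ?num_real//.
  by rewrite expr_le1// ler_norml.
have q2 : `|q| ^+ 2 = 1 - `|c| ^+ 2 by rewrite !real_normK ?num_real.
have := sqr_ge0 (`|c| - `|s|); have := sqr_ge0 (`|q| - `|p|).
by move: p2 q2; move: `|c| `|s| `|q| `|p| => C S Q' P'; nra.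
Qed.

(** Schur's inequality is applied in the variable s to D_y P(s x); its
    hypothesis at s is Bernstein's inequality on an ellipse through s x whose
    conjugate radius is sqrt (1 - s^2) y. *)
Lemma markov_directional V n P x y (B : R) :
  convex_set V -> origin_symmetric V -> coord_bounded B V ->
  poly_space n P -> V x -> V y ->
  normc (dirderiv y P x) <= n%:R ^+ 2 * supnorm V P.
Proof.
move=> cV sV VB Pn Vx Vy.
have [f [sf fE]] := radial_derivative x y Pn.
have := fE 1; rewrite scale1r => ->.
rewrite expr2 -mulrA; apply: schur_inequality_at1 => // s s1.
rewrite -fE -[Num.sqrt _]ger0_norm ?sqrtr_ge0// -normc_real -normcM -dirderivZl.
apply: (bernstein_on_ellipse Pn) => c q qc.
by apply: (peval_le_supnorm _ VB); exact: ellipse_in_convex.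
Qed.

End MarkovInequality.

(** * Ridge polynomials and the extremal example *)

Section Ridge.
Variables (R : realType) (m : nat).
Implicit Types (p : {poly R}) (a x t : 'rV[R]_m) (C : R[i]) (V : set 'rV[R]_m).
Import ComplexField.Normc.

Definition linform a : {mpoly R[i][m]} := \sum_(j < m) (a 0 j)%:C *: 'X_j.
(** The polynomial x |-> p((a, x)). *)
Definition ridge a p : {mpoly R[i][m]} :=
  (map_poly (fun c : R => (c%:C)%:MP_[m]) p).[linform a].

Lemma peval_linform a x : peval (linform a) x = (dot a x)%:C.
Proof.
rewrite /peval raddf_sum /dot rmorph_sum; apply: eq_bigr => j _.
by rewrite /= mevalZ mevalXU rmorphM.
Qed.

Lemma dirderiv_linform t a x : dirderiv t (linform a) x = (dot t a)%:C.
Proof.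
rewrite /linform /dot rmorph_sum /=.
transitivity (\sum_(j < m) dirderiv t ((a 0 j)%:C *: 'X_j) x).
  by elim/big_rec2: _ => [|j q r _ <-]; [exact: dirderiv0|exact: dirderivD].
by apply: eq_bigr => j _; rewrite dirderivZ dirderivX rmorphM mulrC.
Qed.

(** The recursion matching induction on univariate polynomials by their
    constant coefficient. *)
Lemma ridge_rec a p (c : R) :
  ridge a (p * 'X + c%:P) = ridge a p * linform a + (c%:C)%:MP.
Proof.
pose g := [the {rmorphism _ -> _} of (@mpolyC m R[i]) \o (real_complex R)].
have E q : ridge a q = (map_poly g q).[linform a] by [].
by rewrite !E rmorphD rmorphM /= map_polyX map_polyC hornerD hornerC hornerMX.
Qed.

Lemma ridge0 a : ridge a 0 = 0.
Proof. by rewrite /ridge map_poly0 horner0. Qed.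

Lemma peval_ridge a p x : peval (ridge a p) x = (p.[dot a x])%:C.
Proof.
elim/poly_ind: p => [|p c IH]; first by rewrite ridge0 peval0 horner0.
rewrite ridge_rec pevalD pevalM IH peval_linform [peval _%:MP _]mevalC.
by rewrite hornerD hornerC hornerMX rmorphD rmorphM.
Qed.

Lemma dirderiv_ridge t a p x :
  dirderiv t (ridge a p) x = (p^`().[dot a x])%:C * (dot t a)%:C.
Proof.
elim/poly_ind: p => [|p c IH].
  by rewrite ridge0 dirderiv0 deriv0 horner0 mul0r.
rewrite ridge_rec dirderivD dirderivC addr0 dirderivM IH.
rewrite peval_linform peval_ridge dirderiv_linform.
rewrite derivD derivC addr0 derivM derivX mulr1 hornerD hornerMX rmorphD rmorphM.
by rewrite mulrDl mulrAC.
Qed.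

Lemma msize_linform a : (msize (linform a) <= 2)%N.
Proof.
apply: leq_trans (msize_sum _ _ _) _; apply/bigmax_leqP_seq => j _ _.
by apply: leq_trans (msizeZ_le _ _) _; rewrite msizeX mdeg1.
Qed.

Lemma msize_ridge a p : (msize (ridge a p) <= size p)%N.
Proof.
elim/poly_ind: p => [|p c IH]; first by rewrite ridge0 msize0.
have [->|p0] := eqVneq p 0.
  rewrite ridge_rec ridge0 !mul0r !add0r msizeC size_polyC.
  by rewrite (_ : (c%:C == 0) = (c == 0)) // -(inj_eq (@complexI R)).
rewrite ridge_rec size_MXaddC (negPf p0) /=.
apply: leq_trans (msizeD_le _ _) _; rewrite geq_max; apply/andP; split.
  have [->|L0] := eqVneq (linform a) 0; first by rewrite mulr0 msize0.
  have [->|r0] := eqVneq (ridge a p) 0; first by rewrite mul0r msize0.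
  rewrite msizeM // -subn1 leq_subLR add1n.
  by rewrite -[X in (_ <= X)%N]addn2 leq_add // msize_linform.
by rewrite msizeC; case: eqP.
Qed.

Lemma chebyshev_ridge_ridge n a C :
  chebyshev_ridge n a C = C *: ridge a (chebyshevT R n).
Proof. by []. Qed.

Lemma chebyshev_ridge_in_poly_space n a C : poly_space n (chebyshev_ridge n a C).
Proof.
rewrite /poly_space /= chebyshev_ridge_ridge; apply: leq_trans (msizeZ_le _ _) _.
exact: leq_trans (msize_ridge _ _) (size_chebyshev _ _).
Qed.

Lemma dirderiv_chebyshev_ridge n a C t x :
  cdot t (gradient (chebyshev_ridge n a C) x) =
    (C * ((chebyshevT R n)^`().[dot a x])%:C) * (dot t a)%:C.
Proof.
by rewrite chebyshev_ridge_ridge -/(dirderiv _ _ _) dirderivZ dirderiv_ridge mulrA.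
Qed.

Lemma normc_deriv_chebyshev_pm1 n (s : R) : s = 1 \/ s = -1 ->
  `|(chebyshevT R n)^`().[s]| = n%:R ^+ 2.
Proof.
rewrite deriv_chebyshev hornerZ normrM normr_nat expr2 => -[] ->.
  by rewrite chebyshevV1 normr_nat.
rewrite (chebyshevN n (1 : R)).2 chebyshevV1 !normrM normrN normrX normrN.
by rewrite normr1 expr1n mul1r normr_nat.
Qed.

Lemma supnorm_chebyshev_ridge V n a C x : polar V a -> V x -> dot a x = 1 ->
  supnorm V (chebyshev_ridge n a C) = normc C.
Proof.
move=> Va Vx ax.
have le_C y : V y -> normc (peval (chebyshev_ridge n a C) y) <= normc C.
  move=> Vy; rewrite chebyshev_ridgeE normcM normc_real -[leRHS]mulr1.
  rewrite ler_wpM2l ?normc_ge0// chebyshev_le1 // -ler_norml dotC; exact: Va.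
apply/le_anti/andP; split; first by apply: sup_le le_C; exists x.
have := sup_ge le_C Vx; apply: le_trans.
by rewrite chebyshev_ridgeE ax chebyshev1 mulr1.
Qed.

End Ridge.

(** * The sharp Markov inequality *)

Theorem corollary4p3 (R : realType) (m n : nat) (K V : set 'rV[R]_m) :
  (0 < m)%N ->
  convex_body K -> origin_symmetric K ->
  convex_body V -> origin_symmetric V ->
  [/\ forall (P : {mpoly R[i][m]}) (x : 'rV[R]_m),
        poly_space n P -> V x ->
        cnorm K (gradient P x)
          <= maxnorm K (polar V) * n%:R ^+ 2 * supnorm V P,
      exists a : 'rV[R]_m,
        boundary (polar V) a /\ rnorm K a = maxnorm K (polar V),
      forall a : 'rV[R]_m,
        boundary (polar V) a -> rnorm K a = maxnorm K (polar V) ->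
        [/\ supporting_hyperplane V (hyperplane a 1),
            supporting_hyperplane V (hyperplane a (-1)) &
            forall C : R[i],
              poly_space n (chebyshev_ridge n a C) /\
              forall x0 : 'rV[R]_m,
                (V `&` (hyperplane a 1 `|` hyperplane a (-1))) x0 ->
                cnorm K (gradient (chebyshev_ridge n a C) x0)
                  = maxnorm K (polar V) * n%:R ^+ 2
                    * supnorm V (chebyshev_ridge n a C)]
    & forall c : R,
        (forall (P : {mpoly R[i][m]}) (x : 'rV[R]_m),
           poly_space n P -> V x ->
           cnorm K (gradient P x) <= c * supnorm V P) ->
        maxnorm K (polar V) * n%:R ^+ 2 <= c].
Proof.
move=> m0 bK sK bV sV.
have [cptK cK K0] := bK; have [cptV cV V0] := bV.
have [k k0 kK] := body_contains_cube bK sK.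
have [r r0 rV] := body_contains_cube bV sV.
have [BK BK0 KB] := compact_coord_bounded cptK.
have [BV BV0 VB] := compact_coord_bounded cptV.
have pKB := polar_coord_bounded k0 kK; have pVB := polar_coord_bounded r0 rV.
have Vne : V !=set0 by case: V0 => p /interior_subset; exists p.
set M := maxnorm K (polar V).
have M_ge t y : polar K t -> polar V y -> `|dot t y| <= M.
  by move=> Kt Vy; apply: le_trans (rnorm_ge pKB y Kt) (maxnorm_ge pKB pVB Vy).
have M0 : 0 < M.
  (* Both polars contain a small positive multiple of the same basis vector. *)
  pose j := Ordinal m0; pose d (s : R) : 'rV[R]_m := s *: delta_mx 0 j.
  have dle (s : R) : 0 <= s -> forall i, `|d s 0 i| <= s.
    move=> s0 i; rewrite !mxE eqxx /= normrM ger0_norm // normr_nat.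
    by case: (i == j); rewrite ?mulr1 ?mulr0.
  have mR : 0 < m%:R :> R by rewrite ltr0n.
  pose u := (BK * m%:R)^-1; pose v := (BV * m%:R)^-1.
  have u0 : 0 < u by rewrite invr_gt0 mulr_gt0.
  have v0 : 0 < v by rewrite invr_gt0 mulr_gt0.
  have Ku : polar K (d u) := polar_contains_cube m0 BK0 KB (dle _ (ltW u0)).
  have Vv : polar V (d v) := polar_contains_cube m0 BV0 VB (dle _ (ltW v0)).
  apply: lt_le_trans (M_ge _ _ Ku Vv).
  by rewrite dotZr dot_delta !mxE !eqxx mulr1 normr_gt0 mulf_neq0 ?gt_eqF.
have scaled t : polar K t -> V (M^-1 *: t).
  move=> Kt; apply: bipolar => // y Vy.
  rewrite dotZr normrM gtr0_norm ?invr_gt0// mulrC ler_pdivrMr// mul1r dotC.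
  exact: M_ge.
have boundary_in a : boundary (polar V) a -> polar V a.
  by case; rewrite -(proj1 (closure_id _) (@polar_closed _ _ V)).
have extremal a C x0 : boundary (polar V) a -> rnorm K a = M ->
    dot a x0 = 1 \/ dot a x0 = -1 ->
    cnorm K (gradient (chebyshev_ridge n a C) x0)
      = M * n%:R ^+ 2 * supnorm V (chebyshev_ridge n a C).
  move=> ba aM ax0.
  have [x Vx ax] := boundary_polar_attained cptV Vne sV BV0 VB ba.
  rewrite (cnorm_real_multiple pKB (fun t => dirderiv_chebyshev_ridge n a C t x0)).
  rewrite aM (supnorm_chebyshev_ridge n C (boundary_in _ ba) Vx ax).
  rewrite ComplexField.Normc.normcM normc_real normc_deriv_chebyshev_pm1 //.
  by ring.
have [a0 [ba0 a0M]] := maxnorm_attained_boundary k0 kK r0 rV M0.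
split; first last.
- move=> c cP; have [x Vx ax] := boundary_polar_attained cptV Vne sV BV0 VB ba0.
  have := cP _ x (chebyshev_ridge_in_poly_space n a0 1) Vx.
  rewrite extremal //; last by left.
  rewrite (supnorm_chebyshev_ridge n 1 (boundary_in _ ba0) Vx ax).
  by rewrite ComplexField.Normc.normc1 !mulr1.
- move=> a ba aM; have Va := boundary_in _ ba.
  have [x Vx ax] := boundary_polar_attained cptV Vne sV BV0 VB ba.
  have a_neq0 : a != 0.
    apply/eqP => a0E; move: ax; rewrite a0E dotC dot0r => /esym/eqP.
    by rewrite oner_eq0.
  have ale y : V y -> `|dot a y| <= 1 by move=> Vy; rewrite dotC; exact: Va.
  split.
  + exists a, 1; split=> //; first by exists x.
    by move=> y /ale /ler_normlW.
  + exists (- a), 1; split; first by rewrite oppr_eq0.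
    * apply/seteqP; split=> y; rewrite /hyperplane /= [dot (- a) _]dotC dotNr dotC.
        by move=> ->; rewrite opprK.
      by move=> <-; rewrite opprK.
    * by exists (- x); split; [exact: sV|rewrite /hyperplane /= dotNr ax].
    * by move=> y /ale; rewrite [dot (- a) _]dotC dotNr dotC -normrN => /ler_normlW.
  + move=> C; split; first exact: chebyshev_ridge_in_poly_space.
    by move=> x0 [_ ax0]; exact: extremal.
- by exists a0.
move=> P x Pn Vx; apply: cnorm_le => t Kt.
(* The pairing of t with the gradient is M times D_y P(x), y = t / M in V. *)
have -> : t = M *: (M^-1 *: t) by rewrite scalerA divff ?gt_eqF// scale1r.
rewrite -/(dirderiv _ _ _) dirderivZl ComplexField.Normc.normcM normc_real.
rewrite gtr0_norm//.
rewrite -mulrA ler_pM2l//; apply: markov_directional => //; last exact: scaled.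
exact: VB.
Qed.
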